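(* Let $\mathcal{A}$ be a weight graded algebra. \begin{itemize} \item[(i)] On the level of underlying ns collections, we have \[ \mathcal{U}_{\min}(\mathcal{A})\cong \mathcal{A}^+ . \] \item[(ii)] The underlying ns collection of $\mathcal{U}_{\max}(\mathcal{A})$ has a basis formed by the cosets of tree monomials for which the leftmost input of each internal vertex is a leaf. \end{itemize}
   Context: Work over a field $\Bbbk$. A weight graded algebra $\mathcal{A}$ is a connected ($\mathcal{A}(0)\cong\Bbbk$) monoid in nonsymmetric (ns) collections for the tensor product $(\mathcal{P}\otimes\mathcal{Q})(n)=\bigoplus_{i+j=n}\mathcal{P}(i)\otimes\mathcal{Q}(j)$. Ns operads are reduced and connected. For a ns collection $\mathcal{A}$, its shift up is $\mathcal{A}^+(0)=0$, $\mathcal{A}^+(n)=\mathcal{A}(n-1)$ for $n\ge1$. The max-envelope operad $\mathcal{U}_{\max}(\mathcal{A})$ is the quotient of the free ns operad $\mathcal{T}(\mathcal{A}^+)$ by the ideal generated by $1-\mathrm{id}$ (identifying $\mathcal{A}(0)=\mathcal{A}^+(1)$) and all elements $a_1\circ_1 a_2-a_1\cdot a_2$; the min-envelope operad $\mathcal{U}_{\min}(\mathcal{A})$ is the quotient of $\mathcal{T}(\mathcal{A}^+)$ by the ideal generated by $1-\mathrm{id}$, all $a_1\circ_1 a_2-a_1\cdot a_2$, and all $a_1\circ_i a_2$ for $i\ge 2$. Here $a_1\in\mathcal{A}(k-1)=\mathcal{A}^+(k)$, $a_2\in\mathcal{A}(l-1)=\mathcal{A}^+(l)$, and $a_1\cdot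 a_2\in\mathcal{A}(k+l-2)=\mathcal{A}^+(k+l-1)$. Tree monomials refer to the basis of $\mathcal{T}(\mathcal{A}^+)$ (with the generator $1$ eliminated) obtained from a chosen basis of $\mathcal{A}$: planar trees whose internal vertices with $k$ inputs are decorated by basis elements of $\mathcal{A}(k-1)$.
   Formalization: In the definition of U_min(A), the relations a_1∘_i a_2 = 0 for i≥2 are imposed only for a_2 of positive weight; with a_2 = 1 = id allowed, a_1∘_i 1 = a_1 would vanish and (i) would fail, e.g. for A = k[x]. *)

(* Defs.v *)
From HB Require Import structures.
From mathcomp Require Import all_boot all_order all_algebra.
From mathcomp Require Import finmap.
From mathcomp Require Import monalg.

Set Implicit Arguments.
Unset Strict Implicit.
Unset Printing Implicit Defensive.

Import GRing.Theory.

Inductive dtree (B : Type) : Type :=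
| Leaf : dtree B
| Node : B -> seq (dtree B) -> dtree B.
Arguments Leaf {B}.

Section TreeChoice.
Variable B : choiceType.

Fixpoint dtree_enc (t : dtree B) : GenTree.tree B :=
  match t with
  | Leaf => GenTree.Node 0 [::]
  | Node b cs => GenTree.Node 1 (GenTree.Leaf b :: map dtree_enc cs)
  end.

Fixpoint dtree_dec (g : GenTree.tree B) : dtree B :=
  match g with
  | GenTree.Node 1 (GenTree.Leaf b :: gs) => Node b (map dtree_dec gs)
  | _ => Leaf
  end.

Fixpoint dtree_encK (t : dtree B) : dtree_dec (dtree_enc t) = t :=
  match t return dtree_dec (dtree_enc t) = t with
  | Leaf => erefl
  | Node b cs =>
      f_equal (Node b)
        ((fix F (cs : seq (dtree B)) : map dtree_dec (map dtree_enc cs) = cs :=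
            match cs return map dtree_dec (map dtree_enc cs) = cs with
            | [::] => erefl
            | c :: cs' => f_equal2 cons (dtree_encK c) (F cs')
            end) cs)
  end.

End TreeChoice.

HB.instance Definition _ (B : choiceType) :=
  Equality.copy (dtree B) (can_type (@dtree_encK B)).
HB.instance Definition _ (B : choiceType) :=
  Choice.copy (dtree B) (can_type (@dtree_encK B)).

Section Trees.
Variable B : Type.

Fixpoint leaves (t : dtree B) : nat :=
  match t with
  | Leaf => 1
  | Node _ cs => sumn (map leaves cs)
  end.

(* graft t i s : the tree t with its i-th leaf (0-based, left to right)
   replaced by s; this is t \circ_{i+1} s on tree monomials. *)
Fixpoint graft (t : dtree B) (i : nat) (s : dtree B) : dtree B :=
  match t with
  | Leaf => if i == 0 then s else Leaf
  | Node b cs =>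
      Node b ((fix gs (cs : seq (dtree B)) (i : nat) : seq (dtree B) :=
                 match cs with
                 | [::] => [::]
                 | c :: cs' => if i < leaves c then graft c i s :: cs'
                               else c :: gs cs' (i - leaves c)
                 end) cs i)
  end.

Fixpoint leftmost_leaves (t : dtree B) : bool :=
  match t with
  | Leaf => true
  | Node _ cs => (if cs is Leaf :: _ then true else false)
                 && all leftmost_leaves cs
  end.

Variable wt : B -> nat.

(* tree monomials of T(A^+) with the generator 1 eliminated: a vertex with
   k inputs is decorated by a basis element of A(k-1), k-1 >= 1. *)
Fixpoint wf_tree (t : dtree B) : bool :=
  match t with
  | Leaf => true
  | Node b cs => (0 < wt b) && (size cs == (wt b).+1) && all wf_tree cs
  end.

Definition corolla (b : B) : dtree B := Node b (nseq (wt b).+1 Leaf).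

End Trees.

Section Algebra.
Local Open Scope ring_scope.
Variables (K : fieldType) (B : choiceType).

Definition malg_mul (mu : B -> B -> {malg K[B]}) (x y : {malg K[B]}) : {malg K[B]} :=
  \sum_(b1 <- msupp x) \sum_(b2 <- msupp y) (x@_b1 * y@_b2) *: mu b1 b2.

(* A = free K-vector space on the basis B, with A(n) spanned by the basis
   elements of weight n, product given on basis elements by mu, unit e. *)
Definition is_weight_graded_algebra (wt : B -> nat) (e : B)
    (mu : B -> B -> {malg K[B]}) : Prop :=
  [/\ wt e = 0,
      (forall b, wt b = 0 -> b = e),
      (forall b1 b2 b, b \in msupp (mu b1 b2) -> wt b = (wt b1 + wt b2)%N),
      (forall b, mu e b = << b >> /\ mu b e = << b >>)
    &
      (forall b1 b2 b3,
          malg_mul mu (mu b1 b2) << b3 >> = malg_mul mu << b1 >> (mu b2 b3))].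

(* the shifted collection A^+ : A^+(n) = A(n-1), A^+(0) = 0 *)
Definition in_Aplus (wt : B -> nat) (n : nat) (y : {malg K[B]}) : Prop :=
  forall b, b \in msupp y -> (wt b + 1)%N = n.

End Algebra.

(* The free ns operad T(A^+)/(1 - id), spanned by tree monomials.       *)
Section FreeOperad.
Local Open Scope ring_scope.
Variables (K : fieldType) (B : choiceType) (wt : B -> nat)
          (mu : B -> B -> {malg K[B]}).

Local Notation FO := {malg K[dtree B]}.

Definition homog (n : nat) (x : FO) : Prop :=
  forall t, t \in msupp x -> wf_tree wt t /\ leaves t = n.

Definition comp_l (t : dtree B) (i : nat) (x : FO) : FO :=
  \sum_(s <- msupp x) x@_s *: << graft t i s >>.
Definition comp_r (x : FO) (i : nat) (t : dtree B) : FO :=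
  \sum_(s <- msupp x) x@_s *: << graft s i t >>.

(* operadic ideal generated by R: the smallest subspace containing R and
   closed under partial compositions with arbitrary elements (by linearity,
   tree monomials) on either side. *)
Inductive op_ideal (R : FO -> Prop) : FO -> Prop :=
| oi_gen r : R r -> op_ideal R r
| oi_0 : op_ideal R 0
| oi_add x y : op_ideal R x -> op_ideal R y -> op_ideal R (x + y)
| oi_scale (c : K) x : op_ideal R x -> op_ideal R (c *: x)
| oi_comp_l t i x : wf_tree wt t -> (i < leaves t)%N ->
                    op_ideal R x -> op_ideal R (comp_l t i x)
| oi_comp_r x n i t : wf_tree wt t -> homog n x -> (i < n)%N ->
                      op_ideal R x -> op_ideal R (comp_r x i t).

Definition rel_max (b1 b2 : B) : FO :=
  << graft (corolla wt b1) 0 (corolla wt b2) >>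
  - \sum_(b <- msupp (mu b1 b2)) (mu b1 b2)@_b *: << corolla wt b >>.

Definition Rmax (r : FO) : Prop :=
  exists b1 b2, [/\ (0 < wt b1)%N, (0 < wt b2)%N & r = rel_max b1 b2].

(* additionally a1 \circ_i a2 for i >= 2 (0-based index i >= 1) *)
Definition Rmin (r : FO) : Prop :=
  Rmax r \/
  exists b1 b2 i, [/\ (0 < wt b1)%N, (0 < wt b2)%N, (0 < i <= wt b1)%N &
                      r = << graft (corolla wt b1) i (corolla wt b2) >>].

Definition I_max := op_ideal Rmax.
Definition I_min := op_ideal Rmin.

End FreeOperad.

(* Main.v *)
Require Import Defs.
From HB Require Import structures.
From mathcomp Require Import all_boot all_order all_algebra.
From mathcomp Require Import finmap.
From mathcomp Require Import monalg.

(* Contracting a left edge of a tree preserves its forest of non-spine subtrees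
   (listed in planar order) and, by associativity, the product in A of the
   labels along its left spine. So the coset of a tree in U_max(A) is determined
   by its spine product and its forest of cosets: contraction reduces every tree
   to trees whose leftmost inputs are leaves, and reading off one coefficient of
   the spine product at each level gives linear forms that vanish on the ideal
   and are dual to these trees. Modulo the ideal of U_min(A) a tree with a
   non-left edge vanishes, and a left comb is its spine product. *)

Set Implicit Arguments.
Unset Strict Implicit.
Unset Printing Implicit Defensive.

Import GRing.Theory.

(** * Grafting and contexts *)

Section Trees.
Variable B : Type.
Implicit Types (t s X Y : dtree B) (cs : seq (dtree B)).

(** The generated principle for this nested inductive type has no hypothesis on the children. The
    [foldr] conjunction unfolds to one hypothesis per child when the list is destructed. *)
Definition dtree_all_ind (P : dtree B -> Prop) (PLeaf : P Leaf)
    (PNode : forall b cs, foldr (fun c => and (P c)) True cs -> P (Node b cs)) :=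
  fix F t : P t :=
    match t with
    | Leaf => PLeaf
    | Node b cs => PNode b cs
        ((fix G cs : foldr (fun c => and (P c)) True cs :=
            match cs with
            | [::] => I
            | c :: cs' => conj (F c) (G cs')
            end) cs)
    end.

Definition is_leaf t := if t is Leaf then true else false.

Lemma is_leafP t : reflect (t = Leaf) (is_leaf t).
Proof. by case: t => [|b cs]; constructor. Qed.

Definition leavess cs := sumn (map (@leaves B) cs).

Lemma leavess_cat cs cs' : leavess (cs ++ cs') = (leavess cs + leavess cs')%N.
Proof. by rewrite /leavess map_cat sumn_cat. Qed.

Lemma leavess_leaf cs : all is_leaf cs -> leavess cs = size cs.
Proof. by elim: cs => //= c cs IH /andP[/is_leafP-> /IH]; rewrite /leavess /= => ->. Qed.

(** The anonymous fixpoint inside [graft], named so that inductions on the list of children can be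
    stated. *)
Fixpoint grafts cs i s :=
  match cs with
  | [::] => [::]
  | c :: cs' => if (i < leaves c)%N then graft c i s :: cs'
                else c :: grafts cs' (i - leaves c) s
  end.

Lemma graft_Node b cs i s : graft (Node b cs) i s = Node b (grafts cs i s).
Proof.
congr Node; elim: cs i => //= c cs IH i.
by case: ifP => // _; rewrite IH.
Qed.

Lemma size_grafts cs i s : size (grafts cs i s) = size cs.
Proof. by elim: cs i => //= c cs IH i; case: ifP => //= _; rewrite IH. Qed.

Lemma grafts_cat cs cs' i s :
  grafts (cs ++ cs') i s =
  if (i < leavess cs)%N then grafts cs i s ++ cs'
  else cs ++ grafts cs' (i - leavess cs) s.
Proof.
elim: cs i => [|c cs IH] i /=; first by rewrite subn0.
rewrite {2}/leavess /= -/(leavess cs); case: ltnP => [lt_ic | le_ci].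
  by rewrite (leq_trans lt_ic) ?leq_addr.
rewrite IH -ltn_subLR //; case: ifP => //= _.
by rewrite -subnDA.
Qed.

Fixpoint nodes t :=
  match t with
  | Leaf => 0%N
  | Node _ cs => (sumn (map nodes cs)).+1
  end.

(** A context is the path from the root to a hole; each step stores the vertex label and the
    siblings to the left and to the right of the path. *)
Fixpoint plug (ctx : seq (B * seq (dtree B) * seq (dtree B))) t :=
  match ctx with
  | [::] => t
  | (b, l, r) :: ctx' => Node b (l ++ plug ctx' t :: r)
  end.

Lemma plug_cat ctx ctx' t : plug (ctx ++ ctx') t = plug ctx (plug ctx' t).
Proof. by elim: ctx => //= [[[b l] r] ctx IH]; rewrite IH. Qed.

Lemma leaves_plug ctx X Y : leaves X = leaves Y ->
  leaves (plug ctx X) = leaves (plug ctx Y).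
Proof.
by move=> eqXY; elim: ctx => //= [[[b l] r] ctx IH] /=; rewrite !map_cat /= IH.
Qed.

Lemma nodes_plug ctx X Y : (nodes X < nodes Y)%N ->
  (nodes (plug ctx X) < nodes (plug ctx Y))%N.
Proof.
move=> ltXY; elim: ctx => //= [[[b l] r] ctx IH] /=.
by rewrite !map_cat !sumn_cat /= ltnS ltn_add2l ltn_add2r.
Qed.

Lemma graft_eq_plug t i : (i < leaves t)%N ->
  exists ctx, forall X, graft t i X = plug ctx X.
Proof.
elim/dtree_all_ind: t i => [|b cs IHcs] i.
  by case: i => // _; exists [::].
suff: (i < leavess cs)%N -> exists ctx l r,
    forall X, grafts cs i X = l ++ plug ctx X :: r.
  move=> H /H[ctx [l [r E]]]; exists ((b, l, r) :: ctx) => X.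
  by rewrite graft_Node E.
elim: cs {b} IHcs i => // c cs IHcs /= [IHc /IHcs{}IHcs] i.
rewrite /leavess /= -/(leavess cs); case: (ltnP i (leaves c)) => [/IHc[ctx E] _ | le_ci].
  by exists ctx, [::], cs => X; rewrite E.
rewrite -ltn_subLR // => /IHcs[ctx [l [r E]]].
by exists ctx, (c :: l), r => X; rewrite E.
Qed.

Lemma grafts_oversize cs i s : (leavess cs <= i)%N -> grafts cs i s = cs.
Proof.
elim: cs i => // c cs IH i; rewrite /leavess /= -/(leavess cs) => le_i.
rewrite ltnNge (leq_trans (leq_addr _ _) le_i) /= IH //.
by rewrite leq_subRL // (leq_trans (leq_addr _ _) le_i).
Qed.

Lemma graft_oversize t i s : (leaves t <= i)%N -> graft t i s = t.
Proof.
case: t => [|b cs]; first by case: i.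
by rewrite graft_Node => /grafts_oversize->.
Qed.

(** The grafting position either misses the hole (out-of-range positions included) or falls inside
    the plugged tree. One context or index serves all [X] with the same number of leaves, so the
    lemma applies termwise to a combination of such trees. *)
Lemma graft_plug (ctx : seq (B * seq (dtree B) * seq (dtree B))) X0 i s :
  (exists ctx', forall X, leaves X = leaves X0 ->
     graft (plug ctx X) i s = plug ctx' X)
  \/ (exists2 j, (j < leaves X0)%N & forall X, leaves X = leaves X0 ->
        graft (plug ctx X) i s = plug ctx (graft X j s)).
Proof.
elim: ctx i => [|[[b l] r] ctx IH] i.
  have [lt_im | le_mi] := ltnP i (leaves X0); first by right; exists i.
  by left; exists [::] => X /= eqXm; rewrite graft_oversize // eqXm.
have graftE X : leaves X = leaves X0 -> graft (plug ((b, l, r) :: ctx) X) i s =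
    Node b (if (i < leavess l)%N then grafts l i s ++ plug ctx X :: r
            else l ++ (if (i - leavess l < leaves (plug ctx X0))%N
                       then graft (plug ctx X) (i - leavess l) s :: r
                       else plug ctx X ::
                         grafts r (i - leavess l - leaves (plug ctx X0)) s)).
  by move=> eqX; rewrite [plug _ _]/= graft_Node grafts_cat /= (leaves_plug _ eqX).
case: ltnP graftE => _ graftE.
  by left; exists ((b, grafts l i s, r) :: ctx).
case: ltnP graftE => _ graftE; last first.
  by left; exists ((b, l, grafts r (i - leavess l - leaves (plug ctx X0)) s) :: ctx).
have [[ctx' E] | [j lt_j E]] := IH (i - leavess l)%N.
  by left; exists ((b, l, r) :: ctx') => X eqX; rewrite graftE // E.
by right; exists j => // X eqX; rewrite graftE // E.
Qed.

(** * Left spines and left combs *)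

Fixpoint forest t : seq (dtree B) :=
  match t with
  | Node _ (c :: cs) => forest c ++ cs
  | _ => [::]
  end.

(** When every subtree hanging off the left spine is a leaf, all internal edges are left edges. *)
Definition comb t := all is_leaf (forest t).

Lemma is_leaf_graft t i s : is_leaf (graft t i s) -> is_leaf t.
Proof. by case: t. Qed.

Lemma all_leaf_grafts cs i s : all is_leaf (grafts cs i s) -> all is_leaf cs.
Proof.
elim: cs i => //= c cs IH i; case: ifP => _ /= /andP[].
  by move=> /is_leaf_graft -> ->.
by move=> -> /IH.
Qed.

Lemma all_leaf_grafts_in cs i s : (i < leavess cs)%N ->
  all is_leaf (grafts cs i s) -> is_leaf s.
Proof.
elim: cs i => //= c cs IH i; rewrite /leavess /= -/(leavess cs).
case: (ltnP i (leaves c)) => [lt_i _ | le_ci] /=.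
  by case: c lt_i => // /[!ltnS] /[!leqn0] /eqP-> /andP[].
by rewrite -ltn_subLR // => /IH IHi /andP[_ /IHi].
Qed.

Lemma comb_graft t i s : comb (graft t i s) -> comb t.
Proof.
rewrite /comb; elim/dtree_all_ind: t i => // b [|c cs] // [IHc _] i.
rewrite graft_Node /=; case: ifP => _; rewrite /= !all_cat => /andP[].
  by move=> /IHc-> ->.
by move=> -> /all_leaf_grafts->.
Qed.

(** At the end of the left spine of [t], the forest of [s] becomes a prefix of the new forest. At
    any other leaf the result is a comb only if [s] is a leaf. With [comb_graft], this makes
    non-combs stable under composition on both sides. *)
Lemma comb_graft_in t i s : (i < leaves t)%N -> comb (graft t i s) -> comb s.
Proof.
rewrite /comb; elim/dtree_all_ind: t i => [|b [|c cs]] //.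
  by case.
move=> [IHc _] i; rewrite graft_Node /=; case: (ltnP i (leaves c)) => [lt_i _ | le_ci] /=.
  by rewrite all_cat => /andP[/IHc->].
rewrite -ltn_subLR // => lt_i; rewrite all_cat => /andP[_].
by move=> /(all_leaf_grafts_in lt_i)/is_leafP->.
Qed.

Lemma grafts_leaf n cs s :
  grafts (nseq n Leaf ++ Leaf :: cs) n s = nseq n Leaf ++ s :: cs.
Proof. by elim: n => //= n IH; rewrite subn1 IH. Qed.

Variable wt : B -> nat.

Lemma wf_plug_hole ctx X : wf_tree wt (plug ctx X) -> wf_tree wt X.
Proof.
elim: ctx => //= [[[b l] r] ctx IH] /= /andP[_].
by rewrite all_cat /= => /and3P[_ /IH].
Qed.

Lemma wf_plug_replace ctx X Y : wf_tree wt (plug ctx X) -> wf_tree wt Y ->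
  wf_tree wt (plug ctx Y).
Proof.
move=> + wfY; elim: ctx => //= [[[b l] r] ctx IH] /=.
by rewrite !size_cat !all_cat /= => /and4P[-> -> /IH-> ->].
Qed.

End Trees.

Local Open Scope ring_scope.

(** * Linear extension *)

Section LinearExtension.
Variables (K : fieldType) (T : choiceType) (V : lmodType K).
Implicit Types (g : T -> V) (x : {malg K[T]}).

(** The compositions [comp_l] and [comp_r] and the sum in [rel_max] are instances of this linear
    extension by conversion. *)
Definition lext g x : V := \sum_(t <- msupp x) x@_t *: g t.

(** Lets combinations with different supports be summed over one common finite set. *)
Lemma lextEw g x (d : {fset T}) : (msupp x `<=` d)%fset ->
  lext g x = \sum_(t <- d) x@_t *: g t.
Proof.
move=> le_xd; apply: big_fset_incl => // t _ /mcoeff_outdom->.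
exact: scale0r.
Qed.

Lemma lext_is_linear g : linear (lext g).
Proof.
move=> a x y; pose d := (msupp x `|` msupp y)%fset.
have le_d : (msupp (a *: x + y) `<=` d)%fset.
  by rewrite (fsubset_trans (msuppD_le _ _)) ?fsetSU ?msuppZ_le.
rewrite (lextEw g le_d) (lextEw g (fsubsetUl _ (msupp y))).
rewrite (lextEw g (fsubsetUr (msupp x) _)) scaler_sumr -big_split /=.
by apply: eq_bigr => t _; rewrite mcoeffD mcoeffZ scalerDl scalerA.
Qed.

HB.instance Definition _ g :=
  GRing.isLinear.Build K {malg K[T]} V _ (lext g) (lext_is_linear g).

Lemma lextU g t : lext g << t >> = g t.
Proof. by rewrite /lext msuppU oner_eq0 big_seq_fset1 mcoeffUU scale1r. Qed.

Lemma malg_expand x : x = \sum_(t <- msupp x) x@_t *: << t >>.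
Proof.
rewrite {1}[x]monalgE; apply: eq_bigr => t _; apply/malgP => u.
by rewrite mcoeffZ !mcoeffU mulrnAr mulr1.
Qed.

Lemma eq_in_lext g g' x : {in msupp x, g =1 g'} -> lext g x = lext g' x.
Proof.
by move=> eq_g; apply: eq_big_seq => t xt; rewrite eq_g.
Qed.

Lemma eq_lext g g' : g =1 g' -> lext g =1 lext g'.
Proof. by move=> eq_g x; apply: eq_in_lext => t _; apply: eq_g. Qed.

Lemma lext0 x : lext (fun=> 0) x = 0.
Proof. by rewrite /lext big1 // => t _; rewrite scaler0. Qed.

End LinearExtension.

Lemma linear_lext (K : fieldType) (T : choiceType) (V W : lmodType K)
    (f : {linear V -> W}) (g : T -> V) x :
  f (lext g x) = lext (fun t => f (g t)) x.
Proof. by rewrite linear_sum; apply: eq_bigr => t _; rewrite linearZ. Qed.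

Lemma lext_lext (K : fieldType) (T S : choiceType) (V : lmodType K)
    (g : S -> V) (h : T -> {malg K[S]}) x :
  lext g (lext h x) = lext (fun t => lext g (h t)) x.
Proof. exact: linear_lext. Qed.

Lemma lextB (K : fieldType) (T : choiceType) (V : lmodType K) (g h : T -> V) x :
  lext (fun t => g t - h t) x = lext g x - lext h x.
Proof.
by rewrite /lext -sumrB; apply: eq_bigr => t _; rewrite scalerBr.
Qed.

Lemma lextU1 (K : fieldType) (T : choiceType) (x : {malg K[T]}) :
  lext (fun t => << t >> : {malg K[T]}) x = x.
Proof. by rewrite [RHS]malg_expand. Qed.

Lemma exchange_lext (K : fieldType) (S T : choiceType) (V : lmodType K)
    (g : S -> T -> V) x y :
  lext (fun s => lext (g s) y) x = lext (fun t => lext (g^~ t) x) y.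
Proof.
rewrite /lext; under eq_bigr do rewrite scaler_sumr.
rewrite exchange_big; apply: eq_bigr => t _; rewrite scaler_sumr.
by apply: eq_bigr => s _; rewrite !scalerA mulrC.
Qed.

Lemma msupp_lext (K : fieldType) (T S : choiceType) (g : T -> {malg K[S]}) x s :
  s \in msupp (lext g x) -> exists2 t, t \in msupp x & s \in msupp (g t).
Proof.
rewrite -mcoeff_neq0 => nz.
have /hasP[t xt gts] : has (fun t => s \in msupp (g t)) (msupp x).
  apply: contraNT nz => /hasPn no_s; rewrite raddf_sum big1_seq //= => t /no_s.
  by move=> /mcoeff_outdom gts0; rewrite mcoeffZ gts0 mulr0.
by exists t.
Qed.

Lemma msuppU1P (K : fieldType) (T : choiceType) (t s : T) :
  reflect (s = t) (s \in msupp (<< t >> : {malg K[T]})).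
Proof. by rewrite msuppU oner_eq0 inE; apply: eqP. Qed.

(** * Linear spans *)

Section Span.
Variables (K : fieldType) (V : lmodType K).

Inductive lspan (G : V -> Prop) : V -> Prop :=
| lspan_gen v of G v : lspan G v
| lspan0 : lspan G 0
| lspanD u v of lspan G u & lspan G v : lspan G (u + v)
| lspanZ c v of lspan G v : lspan G (c *: v).

Lemma lspan_map (f : {linear V -> V}) (G : V -> Prop) v :
  (forall u, G u -> G (f u)) -> lspan G v -> lspan G (f v).
Proof.
move=> Gf; elim=> [u /Gf | | u w _ IHu _ IHw | c u _ IHu].
- exact: lspan_gen.
- by rewrite linear0; apply: lspan0.
- by rewrite linearD; apply: lspanD.
- by rewrite linearZ; apply: lspanZ.
Qed.

Lemma lspan_ker (W : lmodType K) (f : {linear V -> W}) (G : V -> Prop) v :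
  (forall u, G u -> f u = 0) -> lspan G v -> f v = 0.
Proof.
move=> Gf; elim=> [u /Gf// | | u w _ IHu _ IHw | c u _ IHu].
- exact: linear0.
- by rewrite linearD IHu IHw addr0.
- by rewrite linearZ_LR IHu scaler0.
Qed.

End Span.

(** * Operadic ideals as linear spans *)

Section Operad.
Variables (K : fieldType) (B : choiceType) (wt : B -> nat).
Variable mu : B -> B -> {malg K[B]}.
Local Notation FO := {malg K[dtree B]}.
Implicit Types (R : FO -> Prop) (x y : FO) (t s : dtree B).
Implicit Types (c cs : seq (dtree B)).

(** Composition with a fixed tree is linear, so a stable family containing the relations spans a
    subspace that contains the ideal. The bound on [i] for left composition matters: an out-of-range
    graft discards the grafted tree. *)
Lemma op_ideal_lspan R (G : FO -> Prop) x :
    (forall r, R r -> G r) ->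
    (forall t i r, (i < leaves t)%N -> G r -> G (comp_l t i r)) ->
    (forall t i r, G r -> G (comp_r r i t)) ->
  op_ideal wt R x -> lspan G x.
Proof.
move=> RG Gl Gr; elim=> [r /RG|  | ? ? _ + _| ? ? _ |t i r _ lt_i _|r n i t _ _ _ _].
- exact: lspan_gen.
- exact: lspan0.
- exact: lspanD.
- exact: lspanZ.
- apply: (@lspan_map _ _ (lext (fun s => << graft t i s >>))) => u.
  exact: Gl.
- apply: (@lspan_map _ _ (lext (fun s => << graft s i t >>))) => u.
  exact: Gr.
Qed.

Lemma comp_lE t i x : comp_l t i x = lext (fun s => << graft t i s >>) x.
Proof. by []. Qed.

Lemma comp_rE t i x : comp_r x i t = lext (fun s => << graft s i t >>) x.
Proof. by []. Qed.

Definition lplug ctx : FO -> FO := lext (fun t => << plug ctx t >>).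

(** A tree minus the contraction of the left edge from [b1] to [b2]: the relation [rel_max] with
    arbitrary subtrees in place of the leaves. *)
Definition redex b1 b2 c0 c1 : FO :=
  << Node b1 (Node b2 c0 :: c1) >>
  - lext (fun b => << Node b (c0 ++ c1) >>) (mu b1 b2).

Lemma lext_redex (V : lmodType K) (g : dtree B -> V) b1 b2 c0 c1 :
  lext g (redex b1 b2 c0 c1) =
  g (Node b1 (Node b2 c0 :: c1)) - lext (fun b => g (Node b (c0 ++ c1))) (mu b1 b2).
Proof.
rewrite /redex linearB /= lextU lext_lext; congr (_ - _).
by apply: eq_lext => b; rewrite lextU.
Qed.

Lemma leaves_redex b1 b2 c0 c1 t : t \in msupp (redex b1 b2 c0 c1) ->
  leaves t = leavess (c0 ++ c1).
Proof.
rewrite leavess_cat; move/(fsubsetP (msuppB_le _ _)); rewrite in_fsetU.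
case/orP => [/msuppU1P-> // | /msupp_lext[b _ /msuppU1P->] /=].
by rewrite map_cat sumn_cat.
Qed.

(** Both terms carry the same subtrees [c0 ++ c1] in planar order, so grafting changes this list
    alone and respects the cut after [c0]. *)
Lemma comp_r_redex b1 b2 c0 c1 i s :
  exists c0' c1', [/\ size c0' = size c0, c0' ++ c1' = grafts (c0 ++ c1) i s
   & comp_r (redex b1 b2 c0 c1) i s = redex b1 b2 c0' c1'].
Proof.
have E1 : graft (Node b1 (Node b2 c0 :: c1)) i s =
    Node b1 (if (i < leavess c0)%N then Node b2 (grafts c0 i s) :: c1
             else Node b2 c0 :: grafts c1 (i - leavess c0) s).
  by rewrite graft_Node; congr Node; rewrite -graft_Node.
have E2 b : graft (Node b (c0 ++ c1)) i s =
    Node b (if (i < leavess c0)%N then grafts c0 i s ++ c1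
            else c0 ++ grafts c1 (i - leavess c0) s).
  by rewrite graft_Node grafts_cat.
have -> : comp_r (redex b1 b2 c0 c1) i s =
    << graft (Node b1 (Node b2 c0 :: c1)) i s >> -
    lext (fun b => << graft (Node b (c0 ++ c1)) i s >>) (mu b1 b2).
  by rewrite comp_rE lext_redex.
have -> : lext (fun b => << graft (Node b (c0 ++ c1)) i s >>) (mu b1 b2) =
    lext (fun b => << Node b (grafts (c0 ++ c1) i s) >> : FO) (mu b1 b2).
  by apply: eq_lext => b; rewrite E2 grafts_cat.
rewrite E1 grafts_cat; case: ifP => _.
  by exists (grafts c0 i s), c1; rewrite size_grafts.
by exists c0, (grafts c1 (i - leavess c0) s).
Qed.

(** With [c0] nonempty, the left spine through [b2] continues into the head of [c0] before and after
    the contraction, which makes the spine invariants agree. *)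
Definition left_gen x := exists ctx b1 b2 c0 c1,
  c0 <> [::] /\ x = lplug ctx (redex b1 b2 c0 c1).

Lemma comp_l_left_gen t i x : (i < leaves t)%N -> left_gen x ->
  left_gen (comp_l t i x).
Proof.
move=> /graft_eq_plug[ctx' E] [ctx [b1 [b2 [c0 [c1 [c0n ->]]]]]].
exists (ctx' ++ ctx), b1, b2, c0, c1; split; first exact: c0n.
rewrite comp_lE /lplug lext_lext; apply: eq_lext => X.
by rewrite lextU E plug_cat.
Qed.

Lemma comp_r_left_gen x i s : left_gen x -> left_gen (comp_r x i s).
Proof.
move=> [ctx [b1 [b2 [c0 [c1 [c0n ->]]]]]].
have eq_leaves X : X \in msupp (redex b1 b2 c0 c1) ->
    leaves X = leaves (Node b1 (c0 ++ c1)) by move/leaves_redex.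
have compE : comp_r (lplug ctx (redex b1 b2 c0 c1)) i s =
    lext (fun X => << graft (plug ctx X) i s >>) (redex b1 b2 c0 c1).
  by rewrite comp_rE /lplug lext_lext; apply: eq_lext => X; rewrite lextU.
(* All trees of the redex have equally many leaves, so the graft misses all of them, changing the
   context, or enters all of them at one index [j]. *)
rewrite compE; have [[ctx' E] | [j _ E]] := graft_plug ctx (Node b1 (c0 ++ c1)) i s.
  exists ctx', b1, b2, c0, c1; split; first exact: c0n.
  by apply: eq_in_lext => X /eq_leaves/E->.
have [c0' [c1' [sz_c0 _ E']]] := comp_r_redex b1 b2 c0 c1 j s.
exists ctx, b1, b2, c0', c1'; split.
  by case: c0 c0n c0' sz_c0 {E' E eq_leaves compE} => // ? ? _ [].
rewrite -E' comp_rE /lplug lext_lext; apply: eq_in_lext => X /eq_leaves/E->.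
by rewrite lextU.
Qed.

End Operad.

(** * Coefficients of normal forms *)

Section Coefficients.
Variables (K : fieldType) (B : choiceType) (wt : B -> nat) (e : B).
Variable mu : B -> B -> {malg K[B]}.
Hypothesis algA : is_weight_graded_algebra wt e mu.
Local Notation mul := (malg_mul mu).

Lemma malg_mulE x y : mul x y = lext (fun b => lext (mu b) y) x.
Proof.
rewrite /lext; apply: eq_bigr => b1 _; rewrite scaler_sumr.
by apply: eq_bigr => b2 _; rewrite scalerA.
Qed.

Lemma malg_mulUU b1 b2 : mul << b1 >> << b2 >> = mu b1 b2.
Proof. by rewrite malg_mulE !lextU. Qed.

Lemma malg_mul1 x : mul << e >> x = x.
Proof.
have [_ _ _ mu1 _] := algA; rewrite malg_mulE lextU [RHS]malg_expand.
by apply: eq_bigr => b _; have [-> _] := mu1 b.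
Qed.

Lemma malg_mulr1 x : mul x << e >> = x.
Proof.
have [_ _ _ mu1 _] := algA; rewrite malg_mulE [RHS]malg_expand.
by apply: eq_bigr => b _; rewrite lextU; have [_ ->] := mu1 b.
Qed.

Lemma malg_mulA x y z : mul x (mul y z) = mul (mul x y) z.
Proof.
have [_ _ _ _ muA] := algA; rewrite !malg_mulE lext_lext.
apply: eq_lext => b1; rewrite !lext_lext; apply: eq_lext => b2.
rewrite lext_lext exchange_lext; apply: eq_lext => b3.
move: (muA b1 b2 b3); rewrite !malg_mulE lextU => <-.
by apply: eq_lext => b; rewrite lextU.
Qed.

(** The product in A of the labels along the left spine, read from the root. A childless vertex,
    which is never well formed, gets the unit as a default. *)
Fixpoint sprod (t : dtree B) : {malg K[B]} :=
  match t with
  | Leaf => << e >>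
  | Node b cs => mul << b >> (if cs is c :: _ then sprod c else << e >>)
  end.

(** Either the hole lies on the left spine, or it lies in one tree of the forest. In the second case
    the remaining context is strictly shorter, which drives the induction in [coef_plug]. *)
Lemma spine_plug ctx :
  (exists w r, forall X, sprod (plug ctx X) = mul w (sprod X)
                      /\ forest (plug ctx X) = forest X ++ r) \/
  (exists p l ctx' r, (size ctx' < size ctx)%N /\
     forall X, sprod (plug ctx X) = p
            /\ forest (plug ctx X) = l ++ plug ctx' X :: r).
Proof.
elim: ctx => [|[[b [|c l]] r] ctx IH].
- by left; exists << e >>, [::] => X /=; rewrite malg_mul1 cats0.
- have [[w [r' E]]|[p [l [ctx' [r' [lt_ctx' E]]]]]] := IH.
    left; exists (mul << b >> w), (r' ++ r) => X /=; have [-> ->] := E X.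
    by rewrite malg_mulA catA.
  right; exists (mul << b >> p), l, ctx', (r' ++ r); split; first exact: ltnW.
  by move=> X /=; have [-> ->] := E X; rewrite -catA.
- right; exists (mul << b >> (sprod c)), (forest c ++ l), ctx, r; split=> // X.
  by rewrite /= -catA.
Qed.

(** A tensor product of forms evaluated on a tuple; the default 0 makes forests of the wrong length
    pair to zero. *)
Fixpoint prodapp (fs : seq (dtree B -> K)) (ts : seq (dtree B)) : K :=
  match fs, ts with
  | [::], [::] => 1
  | f :: fs', t :: ts' => f t * prodapp fs' ts'
  | _, _ => 0
  end.

(* For u with leaves as leftmost inputs, [coef u t] is the coefficient of u in the
   normal form of t; taking one u at a time replaces the multilinear expansion of
   the forest by a product of scalars. *)
Fixpoint coef (u t : dtree B) : K :=
  match u with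
  | Leaf => (is_leaf t)%:R
  | Node b ds => (sprod t)@_b * prodapp (map coef ds) (Leaf :: forest t)
  end.

(** With all entries but one fixed, a product of forms is a multiple of a single form in that entry;
    if the lengths differ, the multiple is 0. *)
Lemma prodapp_coef_cat ds l r :
  exists a d, forall X, prodapp (map coef ds) (l ++ X :: r) = a * coef d X.
Proof.
elim: l ds => [|t l IH] [|d ds] /=; try by exists 0, Leaf => X; rewrite mul0r.
  by exists (prodapp (map coef ds) r), d => X; rewrite mulrC.
have [a [d' E]] := IH ds; exists (coef d t * a), d' => X.
by rewrite E mulrA.
Qed.

Lemma is_leaf_plug_Node ctx (b : B) cs : is_leaf (plug ctx (Node b cs)) = false.
Proof. by case: ctx => // [[[]]]. Qed.

(** Here associativity of A enters. *)
Lemma sprod_redex b1 b2 c0 c1 : c0 <> [::] ->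
  sprod (Node b1 (Node b2 c0 :: c1)) =
  lext (fun b => sprod (Node b (c0 ++ c1))) (mu b1 b2).
Proof.
case: c0 => [//|c c0] _ /=.
rewrite malg_mulA malg_mulUU malg_mulE; apply: eq_lext => b.
by rewrite malg_mulE lextU.
Qed.

Lemma forest_redex b b1 b2 (c0 c1 : seq (dtree B)) : c0 <> [::] ->
  forest (Node b (c0 ++ c1)) = forest (Node b1 (Node b2 c0 :: c1)).
Proof. by case: c0 => //= c c0 _; rewrite catA. Qed.

Lemma mul_lext (T : choiceType) w (h : T -> {malg K[B]}) x :
  mul w (lext h x) = lext (fun t => mul w (h t)) x.
Proof.
rewrite malg_mulE; under eq_lext do rewrite lext_lext.
by rewrite exchange_lext; apply: eq_lext => t; rewrite malg_mulE.
Qed.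

(** If the redex is on the spine, the forest is unchanged and the spine product is linear in the
    contracted label. Otherwise the contraction happens inside one tree of the forest, in a shorter
    context and against another [u]; hence the induction on the context size for all [u]. *)
Lemma coef_plug u ctx b1 b2 c0 c1 : c0 <> [::] ->
  coef u (plug ctx (Node b1 (Node b2 c0 :: c1))) =
  lext (fun b => coef u (plug ctx (Node b (c0 ++ c1))) : K^o) (mu b1 b2).
Proof.
move=> c0n; have [n] := ubnP (size ctx); elim: n ctx u => // n IHn ctx [|b ds].
  rewrite /= is_leaf_plug_Node.
  by under eq_lext do rewrite is_leaf_plug_Node; rewrite lext0.
rewrite ltnS => le_n.
have [[w [r E]]|[p [l [ctx' [r [lt_ctx' E]]]]]] := spine_plug ctx.
  rewrite [LHS]/=; have [-> ->] := E (Node b1 (Node b2 c0 :: c1)).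
  under eq_lext => b'.
    rewrite /=; have [-> ->] := E (Node b' (c0 ++ c1)).
    rewrite (forest_redex _ b1 b2) //; over.
  rewrite sprod_redex // mul_lext /lext raddf_sum mulr_suml.
  by apply: eq_bigr => b' _; rewrite /= mcoeffZ -mulrA.
have [a [d Ea]] := prodapp_coef_cat ds (Leaf :: l) r.
have coefE X : coef (Node b ds) (plug ctx X) = p@_b * a * coef d (plug ctx' X).
  by rewrite /=; have [-> ->] := E X; rewrite -cat_cons Ea mulrA.
rewrite coefE IHn ?(leq_trans lt_ctx') //.
under [RHS]eq_lext do rewrite coefE.
rewrite /lext mulr_sumr; apply: eq_bigr => b' _; exact: mulrCA.
Qed.

Lemma eq_Node (b b' : B) cs cs' :
  (Node b cs == Node b' cs') = (b == b') && (cs == cs').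
Proof.
by apply/eqP/andP => [[-> ->]|[/eqP-> /eqP->]].
Qed.

(** If the leftmost inputs of [t] are leaves, its spine is at most one vertex: the spine product is
    that label, or the unit, and the forest consists of the other children. *)
Lemma coef_leftmost u t : wf_tree wt u ->
  leftmost_leaves u -> leftmost_leaves t -> coef u t = (u == t)%:R.
Proof.
have [wte _ _ _ _] := algA.
elim/dtree_all_ind: u t => [|b ds IH] t.
  by case: t => //= b cs _ _ _.
case: ds IH => [|[|? ?] ds] //= [_ IH] /andP[/andP[wtb _] wfds] lds.
case: t => [_|b' [|[|? ?] ts] //= lts].
  (* Here [t] is a leaf with spine product [e]; the label [b] has positive weight, so it differs
     from [e]. *)
  rewrite mcoeffU; case: eqP wtb => [<-|_ _]; first by rewrite wte.
  by rewrite mul0r.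
rewrite malg_mulr1 mcoeffU mul1r eq_Node eqseq_cons eqxx (eq_sym b) /=.
rewrite -mulnb natrM; congr (_ * _).
elim: ds ts IH wfds lds lts => [|d ds IHds] [|t ts] //= [IHd IH].
move=> /andP[wfd wfds] /andP[ld lds] /andP[lt lts].
by rewrite IHd // IHds // eqseq_cons -mulnb natrM.
Qed.

Lemma coef_left_gen u x : left_gen mu x -> lext (coef u : _ -> K^o) x = 0.
Proof.
move=> [ctx [b1 [b2 [c0 [c1 [c0n ->]]]]]].
rewrite /lplug lext_lext; under eq_lext do rewrite lextU.
by rewrite lext_redex coef_plug // subrr.
Qed.

(** Each [coef u] kills the span, but by duality it reads off the coefficient of [u] in [y]. *)
Lemma leftmost_free y :
  (forall t, t \in msupp y -> wf_tree wt t /\ leftmost_leaves t) ->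
  lspan (left_gen mu) y -> y = 0.
Proof.
move=> y_ok /lspan_ker y_ker; apply/malgP => u; rewrite mcoeff0.
have [yu|/mcoeff_outdom//] := boolP (u \in msupp y).
have [wfu lu] := y_ok u yu.
have <- : lext (coef u : _ -> K^o) y = 0 by apply: y_ker; apply: coef_left_gen.
rewrite (@eq_in_lext _ _ _ _ (fun t => << t >>@_u : K^o)) => [|t /y_ok[wft lt]].
  by rewrite {1}[y]malg_expand raddf_sum; apply: eq_bigr => t _; rewrite /= mcoeffZ.
by rewrite coef_leftmost // mcoeffU eq_sym.
Qed.

(** * The map from tree monomials to A that induces the isomorphism for U_min(A) *)

Definition comb_sprod (t : dtree B) : {malg K[B]} :=
  if comb t then sprod t else 0.

(** Off the spine, both sides of the redex are non-combs. On the spine their forests coincide, so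
    they are combs together, with equal spine products. *)
Lemma comb_sprod_left_gen x : left_gen mu x -> lext comb_sprod x = 0.
Proof.
move=> [ctx [b1 [b2 [c0 [c1 [c0n ->]]]]]].
rewrite /lplug lext_lext; under eq_lext do rewrite lextU.
rewrite lext_redex /comb_sprod /comb.
have [[w [r E]]|[p [l [ctx' [r [_ E]]]]]] := spine_plug ctx; last first.
  have noncomb b cs : all (@is_leaf B) (forest (plug ctx (Node b cs))) = false.
    have [_ ->] := E (Node b cs).
    by rewrite all_cat /= is_leaf_plug_Node andbF.
  rewrite noncomb; under eq_lext do rewrite noncomb.
  by rewrite lext0 subrr.
have [-> ->] := E (Node b1 (Node b2 c0 :: c1)).
under eq_lext => b.
  have [-> ->] := E (Node b (c0 ++ c1)); rewrite (forest_redex _ b1 b2) //; over.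
case: ifP => _; last by rewrite lext0 subrr.
by rewrite sprod_redex // mul_lext subrr.
Qed.

End Coefficients.

Lemma notall_split (T : Type) (p : pred T) s : ~~ all p s ->
  exists l a r, ~~ p a /\ s = l ++ a :: r.
Proof.
elim: s => //= a s IH; rewrite negb_and => /orP[pa|/IH[l [b [r [pb ->]]]]].
  by exists [::], a, s.
by exists (a :: l), b, r.
Qed.

(** * Reduction modulo the ideals *)

Section Ideals.
Variables (K : fieldType) (B : choiceType) (wt : B -> nat) (e : B).
Variable mu : B -> B -> {malg K[B]}.
Hypothesis algA : is_weight_graded_algebra wt e mu.
Local Notation FO := {malg K[dtree B]}.
Local Notation wf := (wf_tree wt).
Implicit Types (R : FO -> Prop) (x y : FO) (t s : dtree B).
Implicit Types (cs : seq (dtree B)).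

Lemma homogD n x y : homog wt n x -> homog wt n y -> homog wt n (x + y).
Proof.
move=> hx hy t /(fsubsetP (msuppD_le _ _)); rewrite in_fsetU.
by case/orP => [/hx|/hy].
Qed.

Lemma homogZ n (c : K) x : homog wt n x -> homog wt n (c *: x).
Proof. by move=> hx t /(fsubsetP (msuppZ_le _ _))/hx. Qed.

Lemma homogU t : wf t -> homog wt (leaves t) (<< t >> : FO).
Proof. by move=> wft s /msuppU1P->. Qed.

Lemma op_ideal_lext R (T : choiceType) (h : T -> FO) (z : {malg K[T]}) :
  (forall a, a \in msupp z -> op_ideal wt R (h a)) ->
  op_ideal wt R (lext h z).
Proof.
move=> Ih; rewrite /lext big_seq; elim/big_rec: _ => [|t u /Ih It Iu].
  exact: oi_0.
by apply: oi_add => //; apply: oi_scale.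
Qed.

(** Every context is left composition with the tree that has a leaf at the hole, so ideals are
    stable under contexts. *)
Lemma graft_plug_leaf (ctx : seq (B * seq (dtree B) * seq (dtree B))) :
  exists2 i, (i < leaves (plug ctx Leaf))%N &
    forall X, graft (plug ctx Leaf) i X = plug ctx X.
Proof.
elim: ctx => [|[[b l] r] ctx [i lt_i E]]; first by exists 0%N.
exists (leavess l + i)%N => [|X]; rewrite [plug _ _]/=.
  by rewrite [leaves _]leavess_cat ltn_add2l /leavess /= ltn_addr.
rewrite graft_Node grafts_cat ltnNge leq_addr /= addKn lt_i.
by rewrite E.
Qed.

Lemma op_ideal_plug R ctx x :
  wf (plug ctx Leaf) -> op_ideal wt R x -> op_ideal wt R (lplug ctx x).
Proof.
move=> wf_ctx Ix; have [i lt_i E] := graft_plug_leaf ctx.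
have -> : lplug ctx x = comp_l (plug ctx Leaf) i x.
  by rewrite comp_lE; apply: eq_lext => X; rewrite E.
exact: oi_comp_l.
Qed.

(* Grafting onto the rightmost leaves first keeps the positions of the
   remaining leaves. *)
Lemma op_ideal_fill R (P : seq (dtree B) -> FO) n :
    (forall cs i s, size cs = n -> comp_r (P cs) i s = P (grafts cs i s)) ->
    (forall cs, size cs = n -> all wf cs -> homog wt (leavess cs) (P cs)) ->
    op_ideal wt R (P (nseq n Leaf)) ->
  forall cs, size cs = n -> all wf cs -> op_ideal wt R (P cs).
Proof.
move=> compP homP IP cs szcs wfcs.
suff: forall m r, (m + size r)%N = n -> all wf r ->
    op_ideal wt R (P (nseq m Leaf ++ r)) by move/(_ 0%N cs szcs wfcs).
move=> m r; elim: r m => [|c r IH] m /=; first by rewrite addn0 cats0 => ->.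
rewrite addnS -addSn => szr /andP[wfc wfr].
have nseqS : nseq m.+1 Leaf ++ r = nseq m (@Leaf B) ++ Leaf :: r.
  by elim: (m) => //= k <-.
have sz : size (nseq m (@Leaf B) ++ Leaf :: r) = n.
  by rewrite size_cat size_nseq /= -addSnnS.
have wfr' : all wf (nseq m Leaf ++ Leaf :: r).
  by rewrite all_cat /= wfr andbT; elim: (m).
rewrite -grafts_leaf -compP //.
apply: oi_comp_r wfc (homP _ sz wfr') _ _.
  by rewrite leavess_cat (@leavess_leaf _ (nseq m Leaf)) ?all_nseq ?orbT //
             size_nseq -[X in (X < _)%N]addn0 ltn_add2l.
by rewrite -nseqS; apply: IH.
Qed.

Lemma wf_contract b b1 b2 c0 c1 : b \in msupp (mu b1 b2) ->
  wf (Node b1 (Node b2 c0 :: c1)) -> wf (Node b (c0 ++ c1)).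
Proof.
have [_ _ wt_mu _ _] := algA => /wt_mu wtb.
rewrite /= !all_cat size_cat wtb eqSS.
move=> /and3P[/andP[wtb1 /eqP->] /andP[/andP[_ /eqP->] ->] ->].
by rewrite addn_gt0 wtb1 addSn addnC eqxx.
Qed.

Lemma homog_redex b1 b2 c0 c1 : wf (Node b1 (Node b2 c0 :: c1)) ->
  homog wt (leavess (c0 ++ c1)) (redex mu b1 b2 c0 c1).
Proof.
move=> wfN t tx; split; last exact: leaves_redex tx.
move/(fsubsetP (msuppB_le _ _)): tx; rewrite in_fsetU.
case/orP => [/msuppU1P-> // | /msupp_lext[b mub /msuppU1P->]].
exact: wf_contract mub wfN.
Qed.

Lemma rel_maxE b1 b2 :
  rel_max wt mu b1 b2 =
  redex mu b1 b2 (nseq (wt b2).+1 Leaf) (nseq (wt b1) Leaf).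
Proof.
have [_ _ wt_mu _ _] := algA.
have graftE : graft (corolla wt b1) 0 (corolla wt b2) =
    Node b1 (Node b2 (nseq (wt b2).+1 Leaf) :: nseq (wt b1) Leaf) by [].
have sumE : lext (fun b => << corolla wt b >>) (mu b1 b2) = lext (fun b =>
    << Node b (nseq (wt b2).+1 Leaf ++ nseq (wt b1) Leaf) >> : FO) (mu b1 b2).
  apply: eq_in_lext => b /wt_mu wtb.
  by rewrite /corolla wtb -nseqD addSn (addnC (wt b2)).
by rewrite /rel_max /redex graftE -sumE /lext.
Qed.

(** Grafting the subtrees [c0 ++ c1] onto the leaves of [rel_max] yields the redex. [R] is any
    family containing the associativity relations. *)
Lemma op_ideal_redex R b1 b2 c0 c1 : (forall r, Rmax wt mu r -> R r) ->
  wf (Node b1 (Node b2 c0 :: c1)) -> op_ideal wt R (redex mu b1 b2 c0 c1).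
Proof.
move=> maxR wfN; set k := (wt b2).+1; set n := (k + wt b1)%N.
pose P cs := redex mu b1 b2 (take k cs) (drop k cs).
move: wfN; rewrite /= => /andP[/andP[wtb1]].
rewrite eqSS => /eqP szc1 /andP[/andP[/andP[wtb2 /eqP szc0] wfc0] wfc1].
have -> : redex mu b1 b2 c0 c1 = P (c0 ++ c1).
  by rewrite /P /k take_size_cat ?drop_size_cat.
apply: (@op_ideal_fill _ _ n); last 2 first.
- by rewrite size_cat szc0 szc1.
- by rewrite all_cat wfc0.
- move=> cs i s szcs.
  have [c0' [c1' [sz_c0' E]]] := comp_r_redex mu b1 b2 (take k cs) (drop k cs) i s.
  rewrite cat_take_drop in E; rewrite /P => ->.
  have szk : size (take k cs) = k by rewrite size_takel ?szcs ?leq_addr.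
  rewrite szk in sz_c0'.
  by rewrite -E take_size_cat ?drop_size_cat.
- move=> cs szcs wfcs; rewrite -{1}(cat_take_drop k cs); apply: homog_redex.
  rewrite /= wtb1 wtb2 size_takel ?szcs ?leq_addr // size_drop szcs addKn !eqxx.
  by rewrite /= -all_cat cat_take_drop.
- rewrite /P /n nseqD take_size_cat ?drop_size_cat ?size_nseq // -rel_maxE.
  by apply: oi_gen; apply: maxR; exists b1, b2.
Qed.

(** Well-formed vertices have children, so the only obstruction is a vertex whose first child is a
    vertex, that is, a contractible left edge. *)
Lemma non_leftmostP t : wf t -> ~~ leftmost_leaves t ->
  exists ctx b1 b2 c0 c1, t = plug ctx (Node b1 (Node b2 c0 :: c1)).
Proof.
elim/dtree_all_ind: t => // b cs IH /andP[/andP[_ sz_cs] wfcs].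
case: cs IH sz_cs wfcs => [|[|b2 c0] c1] // IH _; last first.
  by exists [::], b, b2, c0, c1.
rewrite /= => wfc1 nlc1.
suff [l [r [ctx [b1 [b2 [c0 [c2 E]]]]]]] : exists l r ctx b1 b2 c0 c2,
    c1 = l ++ plug ctx (Node b1 (Node b2 c0 :: c2)) :: r.
  by exists ((b, Leaf :: l, r) :: ctx), b1, b2, c0, c2; rewrite E.
case: IH => _; elim: c1 wfc1 nlc1 => //= c cs IHcs /andP[wfc wfcs].
rewrite negb_and => /orP[nlc|nlcs] [IHc IH].
  have [ctx [b1 [b2 [c0 [c2 ->]]]]] := IHc wfc nlc.
  by exists [::], cs, ctx, b1, b2, c0, c2.
have [l [r [ctx [b1 [b2 [c0 [c2 ->]]]]]]] := IHcs wfcs nlcs IH.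
by exists (c :: l), r, ctx, b1, b2, c0, c2.
Qed.

(** * Reduction to trees whose leftmost inputs are leaves *)

Definition leftmost_mod R n x := exists y,
  [/\ homog wt n y, (forall t, t \in msupp y -> leftmost_leaves t)
    & op_ideal wt R (x - y)].

Lemma leftmost_mod_ideal R n x : op_ideal wt R x -> leftmost_mod R n x.
Proof.
by move=> Ix; exists 0; rewrite subr0; split=> // t; rewrite msupp0.
Qed.

Lemma leftmost_modD R n x y :
  leftmost_mod R n x -> leftmost_mod R n y -> leftmost_mod R n (x + y).
Proof.
move=> [x' [hx lx Ix]] [y' [hy ly Iy]]; exists (x' + y'); split.
- exact: homogD.
- move=> t /(fsubsetP (msuppD_le _ _)); rewrite in_fsetU.
  by case/orP => [/lx|/ly].
- by rewrite opprD addrACA; apply: oi_add.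
Qed.

Lemma leftmost_modZ R n (a : K) x :
  leftmost_mod R n x -> leftmost_mod R n (a *: x).
Proof.
move=> [x' [hx lx Ix]]; exists (a *: x'); split.
- exact: homogZ.
- by move=> t /(fsubsetP (msuppZ_le _ _))/lx.
- by rewrite -scalerBr; apply: oi_scale.
Qed.

Lemma leftmost_mod_lext R n (T : choiceType) (h : T -> FO) (z : {malg K[T]}) :
  (forall a, a \in msupp z -> leftmost_mod R n (h a)) ->
  leftmost_mod R n (lext h z).
Proof.
move=> Ih; rewrite /lext big_seq; elim/big_rec: _ => [|t u /Ih It Iu].
  exact/leftmost_mod_ideal/oi_0.
by apply: leftmost_modD => //; apply: leftmost_modZ.
Qed.

(** Contracting a left edge merges two vertices into one, so the reduction terminates by induction
    on the number of vertices. *)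
Lemma leftmost_modU R t : (forall r, Rmax wt mu r -> R r) ->
  wf t -> leftmost_mod R (leaves t) << t >>.
Proof.
move=> maxR; have [n] := ubnP (nodes t); elim: n t => // n IHn t lt_n wft.
have [lt|nlt] := boolP (leftmost_leaves t).
  exists << t >>; rewrite subrr; split; last exact: oi_0.
    exact: homogU.
  by move=> s /msuppU1P->.
have [ctx [b1 [b2 [c0 [c1 Et]]]]] := non_leftmostP wft nlt.
have wfX : wf (Node b1 (Node b2 c0 :: c1)) by apply: (@wf_plug_hole _ _ ctx); rewrite -Et.
have tE : << t >> = lplug ctx (redex mu b1 b2 c0 c1) +
    lext (fun b => << plug ctx (Node b (c0 ++ c1)) >>) (mu b1 b2).
  by rewrite /lplug lext_redex -Et subrK.
rewrite tE; apply: leftmost_modD.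
  apply/leftmost_mod_ideal/op_ideal_plug/op_ideal_redex => //.
  by apply: (@wf_plug_replace _ _ _ (Node b1 (Node b2 c0 :: c1))); rewrite -?Et.
apply: leftmost_mod_lext => b mub.
have -> : leaves t = leaves (plug ctx (Node b (c0 ++ c1))).
  by rewrite Et; apply: leaves_plug; rewrite /= map_cat sumn_cat.
apply: IHn.
  rewrite -ltnS; apply: leq_trans lt_n; rewrite ltnS Et; apply: nodes_plug.
  by rewrite /= map_cat sumn_cat.
apply: (@wf_plug_replace _ _ _ (Node b1 (Node b2 c0 :: c1))); first by rewrite -Et.
exact: wf_contract mub wfX.
Qed.

(** * Non-left edges modulo the ideal of U_min(A) *)

Definition inner_edge b1 b2 c0 c1 c2 : dtree B :=
  Node b1 (c0 ++ Node b2 c1 :: c2).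

Lemma graft_inner_edge b1 b2 c0 c1 c2 i s : exists c0' c1' c2',
  [/\ size c0' = size c0, size c1' = size c1,
      c0' ++ c1' ++ c2' = grafts (c0 ++ c1 ++ c2) i s
    & graft (inner_edge b1 b2 c0 c1 c2) i s = inner_edge b1 b2 c0' c1' c2'].
Proof.
rewrite /inner_edge graft_Node !grafts_cat.
case: ltnP => _; first by exists (grafts c0 i s), c1, c2; rewrite size_grafts.
rewrite [grafts (_ :: _) _ _]/= -/(leavess c1); case: ltnP => _.
  exists c0, (grafts c1 (i - leavess c0) s), c2; rewrite size_grafts.
  by rewrite -graft_Node.
by exists c0, c1, (grafts c2 (i - leavess c0 - leavess c1) s).
Qed.

(** Filling the leaves of the relation that kills the composite of two corollas at a non-left input
    gives every tree with such an edge at the root. *)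
Lemma op_ideal_inner_edge b1 b2 c0 c1 c2 : (0 < size c0)%N ->
  wf (inner_edge b1 b2 c0 c1 c2) ->
  I_min wt mu << inner_edge b1 b2 c0 c1 c2 >>.
Proof.
move=> c0_gt0; rewrite /inner_edge /= size_cat all_cat /= addnS eqSS.
case/and3P=> /andP[wtb1 /eqP sz02] wfc0 /andP[/andP[/andP[wtb2 /eqP sz1] wfc1] wfc2].
set i := size c0; set k := size c1; set n := (i + (k + size c2))%N.
(* Cuts one planar list into the subtrees before [b2], above [b2] and after [b2], the form that
   [op_ideal_fill] fills. *)
pose T cs := inner_edge b1 b2 (take i cs) (take k (drop i cs)) (drop k (drop i cs)).
have TE a b c : size a = i -> size b = k -> T (a ++ b ++ c) = inner_edge b1 b2 a b c.
  by move=> sza szb; rewrite /T take_size_cat ?drop_size_cat ?take_size_cat.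
have TV cs : size cs = n -> exists a b c,
    [/\ size a = i, size b = k, size c = size c2 & cs = a ++ b ++ c].
  move=> szcs; exists (take i cs), (take k (drop i cs)), (drop k (drop i cs)).
  by rewrite !cat_take_drop !size_takel ?size_drop ?szcs /n ?addKn ?leq_addr //.
rewrite -/(inner_edge _ _ _ _ _) -TE //.
apply: (@op_ideal_fill _ (fun cs => << T cs >>) n).
- move=> cs j s /TV[a [b [c [sza szb _ ->]]]]; rewrite comp_rE lextU TE //.
  have [a' [b' [c' [sza' szb' <- ->]]]] := graft_inner_edge b1 b2 a b c j s.
  by rewrite TE ?sza' ?szb'.
- move=> cs /TV[a [b [c [sza szb szc ->]]]]; rewrite TE // !all_cat.
  move=> /and3P[wfa wfb wfc].
  have -> : leavess (a ++ b ++ c) = leaves (inner_edge b1 b2 a b c).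
    by rewrite /inner_edge /= map_cat sumn_cat /= !leavess_cat.
  apply: homogU; rewrite /inner_edge /= size_cat all_cat wfa /= wfb wfc sza szb szc.
  by rewrite addnS eqSS sz02 wtb1 wtb2 /k sz1 !eqxx.
- rewrite /n !nseqD TE ?size_nseq //; apply: oi_gen; right.
  exists b1, b2, i; split=> //.
    by rewrite c0_gt0 -sz02 leq_addr.
  (* The [wt b1 + 1] leaves of the first corolla split into [i] leaves, the one replaced, and
     [size c2] more. *)
  congr << _ >>; rewrite /corolla graft_Node -sz02 -addnS nseqD.
  by rewrite [nseq (size c2).+1 _]/= grafts_leaf -sz1.
- by rewrite !size_cat.
- by rewrite !all_cat wfc0 wfc1.
Qed.

(* The unit of A is the only weight 0 basis element and, the generator 1 being
   eliminated, corresponds to the identity tree instead of a corolla. *)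
Definition small_tree b := if wt b == 0%N then Leaf else corolla wt b.

Lemma wf_small_tree b : wf (small_tree b).
Proof.
rewrite /small_tree; case: posnP => //= ->.
by rewrite size_nseq eqxx /= all_nseq orbT.
Qed.

Lemma leaves_small_tree b : leaves (small_tree b) = (wt b).+1.
Proof.
rewrite /small_tree; case: posnP => [-> //| _].
rewrite -[leaves _]/(leavess (nseq (wt b).+1 Leaf)).
by rewrite leavess_leaf ?size_nseq ?all_nseq ?orbT.
Qed.

(** Makes [small_tree] a section of the map to A, which gives surjectivity. *)
Lemma comb_sprod_small_tree b : comb_sprod e mu (small_tree b) = << b >>.
Proof.
have [_ wt0 _ _ _] := algA.
rewrite /small_tree; case: posnP => [/wt0-> //|_].
rewrite /comb_sprod /comb /= all_nseq orbT /=.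
exact: malg_mulr1 algA _.
Qed.

(** Weights add along the spine, and a spine vertex of weight [w] contributes [w] trees to the
    forest. *)
Lemma size_forest_sprod t b : wf t -> b \in msupp (sprod e mu t) ->
  wt b = size (forest t).
Proof.
have [wte _ wt_mu _ _] := algA.
elim/dtree_all_ind: t b => [|b1 [|c cs]] /= => [b _ /msuppU1P-> //||].
  by move=> _ b /andP[/andP[]].
move=> [IHc _] b /andP[/andP[_]]; rewrite eqSS => /eqP sz_cs /andP[wfc _].
rewrite malg_mulE lextU => /msupp_lext[b2 /(IHc _ wfc) wtb2 /wt_mu->].
by rewrite size_cat sz_cs wtb2 addnC.
Qed.

(** The extra leaf is the end of the left spine. *)
Lemma leaves_forest t : wf t -> leaves t = (leavess (forest t)).+1.
Proof.
elim/dtree_all_ind: t => [|b1 [|c cs]] //=; first by move=> _ /andP[/andP[]].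
by move=> [IHc _] /and3P[_ /IHc-> _]; rewrite leavess_cat.
Qed.

Lemma comb_sprod_Node b c cs : all (@is_leaf B) cs ->
  comb_sprod e mu (Node b (c :: cs)) = lext (mu b) (comb_sprod e mu c).
Proof.
move=> leaf_cs; rewrite /comb_sprod /comb /= all_cat leaf_cs andbT.
by case: ifP => _; [rewrite malg_mulE lextU | rewrite linear0].
Qed.

(** For [b2] of positive weight this is a defining relation; for the unit, composing with the
    identity tree changes nothing. *)
Lemma rel_max_small_tree b1 b2 : (0 < wt b1)%N ->
  I_min wt mu (<< graft (corolla wt b1) 0 (small_tree b2) >> -
               lext (fun b => << small_tree b >>) (mu b1 b2)).
Proof.
have [_ wt0 wt_mu mu1 _] := algA.
move=> wtb1; have small_pos b : (0 < wt b)%N -> small_tree b = corolla wt b.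
  by rewrite /small_tree; case: posnP.
have [/wt0->|wtb2] := posnP (wt b2).
  have [_ ->] := mu1 b1; have [wte _ _ _ _] := algA.
  have -> : small_tree e = Leaf by rewrite /small_tree wte.
  have -> : graft (corolla wt b1) 0 Leaf = corolla wt b1 by [].
  by rewrite lextU small_pos // subrr; apply: oi_0.
have -> : lext (fun b => << small_tree b >> : FO) (mu b1 b2) =
    lext (fun b => << corolla wt b >>) (mu b1 b2).
  by apply: eq_in_lext => b /wt_mu wtb; rewrite small_pos // wtb addn_gt0 wtb1.
rewrite small_pos //; apply: oi_gen; left; exists b1, b2.
by rewrite /rel_max /lext.
Qed.

(** Going down the spine, a tree whose root has only leaves beside its first child is a corolla
    composed with that child, which is replaced by its normal form and multiplied. Any other tree
    has a non-left edge at the root and vanishes. *)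
Lemma comb_sprod_mod_I_min t : wf t ->
  I_min wt mu (<< t >> - lext (fun b => << small_tree b >>) (comb_sprod e mu t)).
Proof.
have [wte _ _ _ _] := algA.
elim/dtree_all_ind: t => [_|b [|c cs]].
  by rewrite /comb_sprod /= lextU /small_tree wte subrr; apply: oi_0.
  by move=> _ /andP[/andP[]].
move=> [IHc _] wft; have [leaf_cs|] := boolP (all (@is_leaf B) cs).
  rewrite comb_sprod_Node //; set z := comb_sprod e mu c in IHc *.
  case/andP: wft => /andP[wtb]; rewrite eqSS => /eqP sz_cs /andP[wfc _].
  have tE : << Node b (c :: cs) >> = comp_l (corolla wt b) 0 << c >> :> FO.
    rewrite comp_lE lextU /= -sz_cs; congr << Node _ (_ :: _) >>.
    by elim: cs leaf_cs {sz_cs} => //= _ cs IH /andP[/is_leafP-> /IH{1}->].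
  (* Inserts the corolla composed with the normal form of [c]. One difference is then a composition
     of the induction hypothesis, the other a combination of product relations. *)
  rewrite tE lext_lext -[X in X - _](subrK (comp_l (corolla wt b) 0
    (lext (fun b => << small_tree b >>) z))) -addrA.
  apply: oi_add.
    have wf_b : wf (corolla wt b) by rewrite /= all_nseq orbT wtb size_nseq eqxx.
    have lt0 : (0 < leaves (corolla wt b))%N by [].
    by have := oi_comp_l wf_b lt0 (IHc wfc); rewrite !comp_lE linearB.
  rewrite comp_lE lext_lext -lextB; apply: op_ideal_lext => b2 _.
  by rewrite lextU; apply: rel_max_small_tree.
(* The vertex [b2] found among [cs] has at least [c] to its left, so its edge to the root is not a
   left edge. *)
move=> /notall_split[l [[|b2 c1] [r [// _ cs_eq]]]].
have -> : comb_sprod e mu (Node b (c :: cs)) = 0.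
  by rewrite /comb_sprod /comb /= cs_eq !all_cat /= !andbF.
rewrite linear0 subr0; move: wft; rewrite cs_eq -cat_cons.
exact: op_ideal_inner_edge.
Qed.

Lemma comb_sprod_ker x : I_min wt mu x -> lext (comb_sprod e mu) x = 0.
Proof.
(* The redexes in contexts account for the product relations, the non-comb monomials for the
   relations that kill non-left compositions; both families are stable under composition. *)
pose G x := left_gen mu x \/ exists2 t, ~~ comb t & x = << t >>.
have G0 u : G u -> lext (comb_sprod e mu) u = 0.
  case=> [|[t /negPf nct ->]]; first exact: comb_sprod_left_gen algA _.
  by rewrite lextU /comb_sprod nct.
suff: I_min wt mu x -> lspan G x by move=> h /h; apply: lspan_ker.
apply: op_ideal_lspan => [r|t i r lt_i|t i r].
- case=> [[b1 [b2 [_ _ ->]]]|[b1 [b2 [i [wtb1 wtb2 /andP[i_gt0 le_i] ->]]]]].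
    left; exists [::], b1, b2, (nseq (wt b2).+1 Leaf), (nseq (wt b1) Leaf).
    by split=> [//|]; rewrite rel_maxE /lplug lextU1.
  right; exists (graft (corolla wt b1) i (corolla wt b2)) => //.
  rewrite /corolla graft_Node /comb; case: i i_gt0 le_i => // i _ le_i.
  rewrite /= subn1 /=; apply/negP => /all_leaf_grafts_in.
  by rewrite leavess_leaf ?size_nseq ?all_nseq ?orbT // => /(_ le_i).
- case=> [/(comp_l_left_gen lt_i)|[s ncs ->]]; first by left.
  right; exists (graft t i s); last by rewrite comp_lE lextU.
  by apply: contra ncs; apply: comb_graft_in.
- case=> [/comp_r_left_gen|[s ncs ->]]; first by left.
  right; exists (graft s i t); last by rewrite comp_rE lextU.
  by apply: contra ncs; apply: comb_graft.
Qed.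

Lemma lspan_I_max x : I_max wt mu x -> lspan (left_gen mu) x.
Proof.
apply: op_ideal_lspan => [r [b1 [b2 [_ _ ->]]]|t i r lt_i|t i r].
- exists [::], b1, b2, (nseq (wt b2).+1 Leaf), (nseq (wt b1) Leaf).
  by split=> [//|]; rewrite rel_maxE /lplug lextU1.
- exact: comp_l_left_gen.
- exact: comp_r_left_gen.
Qed.

End Ideals.

Theorem theorem2p3 (K : fieldType) (B : choiceType) (wt : B -> nat) (e : B)
    (mu : B -> B -> {malg K[B]}) :
  is_weight_graded_algebra wt e mu ->
  (* (i) U_min(A) is isomorphic to A^+ as ns collections *)
  (forall n : nat, exists f : {linear {malg K[dtree B]} -> {malg K[B]}},
     [/\ forall x, homog wt n x -> in_Aplus wt n (f x),
         forall y, in_Aplus wt n y -> exists2 x, homog wt n x & f x = y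
       & forall x, homog wt n x -> (f x = 0 <-> I_min wt mu x)])
  /\
  (* (ii) cosets of tree monomials whose internal vertices have a leaf as
     leftmost input form a basis of U_max(A) *)
  (forall n : nat,
     (forall x, homog wt n x ->
        exists y, [/\ homog wt n y,
                      (forall t, t \in msupp y -> leftmost_leaves t)
                    & I_max wt mu (x - y)])
     /\
     (forall y, homog wt n y ->
        (forall t, t \in msupp y -> leftmost_leaves t) ->
        I_max wt mu y -> y = 0)).
Proof.
move=> algA; split=> n; last split=> [x hx|y hy ly /(lspan_I_max algA) y_span].
(* The same linear map serves every arity. *)
- exists (lext (comb_sprod e mu)); split=> [x hx|y hy|x hx].
  + move=> b /msupp_lext[t /hx[wft <-]]; rewrite /comb_sprod.
    case: ifP => [comb_t|_]; last by rewrite msupp0.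
    move=> /(size_forest_sprod algA wft)->.
    by rewrite (leaves_forest wft) leavess_leaf // addn1.
  + exists (lext (fun b => << small_tree wt b >>) y).
      move=> t /msupp_lext[b /hy <- /msuppU1P->].
      by rewrite wf_small_tree leaves_small_tree addn1.
    rewrite /= lext_lext -[RHS]lextU1; apply: eq_lext => b.
    by rewrite lextU comb_sprod_small_tree.
  + split=> [/= fx0|]; last exact: comb_sprod_ker.
    (* When the image is 0, the normal forms of the monomials of [x] cancel, so [x] equals the
       combination of the differences between its monomials and their normal forms. *)
    have -> : x = lext (fun t => << t >> - lext (fun b => << small_tree wt b >>)
                                           (comb_sprod e mu t)) x.
      by rewrite lextB -lext_lext fx0 linear0 subr0 lextU1.
    apply: op_ideal_lext => t /hx[wft _].
    exact: comb_sprod_mod_I_min.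
- rewrite [x]malg_expand; apply: (@leftmost_mod_lext _ _ wt) => t /hx[wft <-].
  exact: (leftmost_modU algA).
- by apply: (leftmost_free algA) y_span => t yt; split; [case: (hy t yt)|apply: ly].
Qed.
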